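(* Let $\hat\mu_i(\mathbf O_{i-1}):\mathbb X\times\mathbb A\to\mathbb R$, $i\in[n]$, be any estimates of $\mu^*$ such that $\hat\mu_i$ depends measurably only on $\mathbf O_{i-1}$. Define the AIPW scores $$\hat\Gamma_i(\mathbf O_i):=\frac{g(X_i,A_i)}{\pi_i^*(X_i,\mathbf O_{i-1};A_i)}\{Y_i-\hat\mu_i(\mathbf O_{i-1})(X_i,A_i)\}+\langle g(X_i,\cdot),\hat\mu_i(\mathbf O_{i-1})(X_i,\cdot)\rangle_{\lambda_{\mathbb A}}$$ and the AIPW estimator $\hat\tau_n^{\mathrm{AIPW}}(\mathbf O_n):=\frac1n\sum_{i=1}^n\hat\Gamma_i(\mathbf O_i)$. Then $$\mathbb E_{\mathcal I^*}\big[\{\hat\tau_n^{\mathrm{AIPW}}(\mathbf O_n)-\tau(\mathcal I^* )\}^2\big]\le\frac1n\Big\{v_*^2+\frac1n\sum_{i=1}^n\mathbb E_{\mathcal I^*}\Big[\frac{g^2(X_i,A_i)\{\hat\mu_i(\mathbf O_{i-1})(X_i,A_i)-\mu^*(X_i,A_i)\}^2}{(\pi_i^* )^2(X_i,\mathbf O_{i-1};A_i)}\Big]\Big\}.$$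
   Context: Setup. Let $(\mathbb X,\lambda_{\mathbb X})$, $(\mathbb A,\lambda_{\mathbb A})$, $(\mathbb Y,\lambda_{\mathbb Y})$ be measurable spaces with $\sigma$-finite measures, $\mathbb Y\subseteq\mathbb R$, and $\mathbb O:=\mathbb X\times\mathbb A\times\mathbb Y$. A problem instance is a pair $\mathcal I=(\Xi,\Gamma)$ where $\Xi$ is a probability measure on $\mathbb X$ and $\Gamma$ is a Markov kernel from $\mathbb X\times\mathbb A$ to $\mathbb Y$. For each $i\in[n]$ a known behavioral policy $\Pi_i^*$ is a Markov kernel from $\mathbb X\times\mathbb O^{i-1}$ to $\mathbb A$ with density $\pi_i^*(x,\mathbf o_{i-1};\cdot):=d\Pi_i^*(\cdot\mid x,\mathbf o_{i-1})/d\lambda_{\mathbb A}$. Under instance $\mathcal I$, data $\mathbf O_n=(X_1,A_1,Y_1,\dots,X_n,A_n,Y_n)$ are generated sequentially: for $i=1,\dots,n$, $X_i\sim\Xi$ independently of $\mathbf O_{i-1}$; $A_i\mid(X_i,\mathbf O_{i-1})\sim\Pi_i^*(\cdot\mid X_i,\mathbf O_{i-1})$; $Y_i\mid(X_i,A_i,\mathbf O_{i-1})\sim\Gamma(\cdot\mid X_i,A_i)$. Here $\mathbf O_i$ denotes the first $i$ triples ($\mathbf O_0=\varnothing$) and $\mathcal H_i:=\sigma(\mathbf O_i)$. $\mathbb E_{\mathcal I}$, $\mathrm{Var}_{\mathcal I}$ denote expectation/variance under this law. The true instance is $\mathcal I^*=(\Xi^*,\Gamma^* )$, with treatment effect $\mu^*(x,a):=\int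 y\,\Gamma^*(dy\mid x,a)$ and conditional variance $\sigma^2(x,a):=\int(y-\mu^*(x,a))^2\Gamma^*(dy\mid x,a)<\infty$. A measurable evaluation function $g:\mathbb X\times\mathbb A\to\mathbb R$ is given; $\langle f,h\rangle_{\lambda_{\mathbb A}}:=\int_{\mathbb A}f(a)h(a)\,d\lambda_{\mathbb A}(a)$. The target is $\tau(\mathcal I^* ):=\mathbb E_{X\sim\Xi^*}[\langle g(X,\cdot),\mu^*(X,\cdot)\rangle_{\lambda_{\mathbb A}}]$. For $\varphi:\mathbb X\times\mathbb A\to\mathbb R$ and $k\in[n]$, $\|\varphi\|_{(k)}^2:=\frac1k\sum_{i=1}^k\mathbb E_{\mathcal I^*}\big[g^2(X_i,A_i)\varphi^2(X_i,A_i)/(\pi_i^* )^2(X_i,\mathbf O_{i-1};A_i)\big]$. The efficient variance is $v_*^2:=\mathrm{Var}_{X\sim\Xi^*}[\langle g(X,\cdot),\mu^*(X,\cdot)\rangle_{\lambda_{\mathbb A}}]+\|\sigma\|_{(n)}^2$. All expectations appearing are assumed finite.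
   Formalization: The formal theorem adds overlap, that each density π_i^*(x,o;a) is positive wherever g(x,a) is nonzero; without it the bound fails, e.g. g(a2)=1, π(a2)=0, g(a1)=0, μ*(a2)=1, estimates 0, no noise: left side 1, right side 0. *)

(* Defs.v *)
From HB Require Import structures.
From mathcomp Require Import all_boot all_order all_algebra.
From mathcomp Require Import all_classical all_reals all_analysis measurable_realfun.
Set Implicit Arguments.
Unset Strict Implicit.
Unset Printing Implicit Defensive.
Import Order.TTheory GRing.Theory Num.Theory.
Local Open Scope classical_set_scope.
Local Open Scope ring_scope.

Notation obs R TX TA := (TX * TA * R)%type.

Section AIPW.
Context {R : realType} {dX dA : measure_display}
  {TX : measurableType dX} {TA : measurableType dA}.

Definition mustar (Gam : R.-pker (TX * TA) ~> R) (x : TX) (a : TA) : R :=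
  fine (\int[Gam (x, a)]_y (y%:E))%E.

Definition sigma2 (Gam : R.-pker (TX * TA) ~> R) (x : TX) (a : TA) : R :=
  fine (\int[Gam (x, a)]_y (((y - mustar Gam x a) ^+ 2)%:E))%E.

Definition ipA (lamA : {measure set TA -> \bar R}) (f h : TA -> R) : R :=
  fine (\int[lamA]_a ((f a * h a)%:E))%E.

Definition tau_star (Xi : probability TX R) (lamA : {measure set TA -> \bar R})
    (Gam : R.-pker (TX * TA) ~> R) (g : TX -> TA -> R) : R :=
  fine (\int[Xi]_x ((ipA lamA (g x) (mustar Gam x))%:E))%E.

Definition var_gmu (Xi : probability TX R) (lamA : {measure set TA -> \bar R})
    (Gam : R.-pker (TX * TA) ~> R) (g : TX -> TA -> R) : \bar R :=
  (\int[Xi]_x (((ipA lamA (g x) (mustar Gam x) - tau_star Xi lamA Gam g) ^+ 2)%:E))%E.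

(* the history O_i = (O_1, ..., O_i) as an i-tuple (observations are
   0-indexed: observation number k+1 of the paper is Ob k) *)
Definition hist {dO} {Omega : measurableType dO} (Ob : nat -> Omega -> obs R TX TA)
    (i : nat) (w : Omega) : i.-tuple (obs R TX TA) :=
  [tuple Ob (nat_of_ord j) w | j < i].

End AIPW.

(* Main.v *)
(* Let S_j be the sum of the first j centred scores and D_j the next one.  Given
   the history O_j, S_j is a constant, and
     E[(S_j + D_j)^2 | O_j] <= S_j^2 + (variance and error terms of D_j)
   follows by integrating out Y, then A, then X, each time splitting a second
   moment into a centred part and the square of a mean.  This replaces the
   orthogonality of martingale differences: over Omega only nonnegative
   functions are integrated, so an infinite right-hand side needs no separate
   treatment. *)

Require Import Defs.
From HB Require Import structures.
From mathcomp Require Import all_boot all_order all_algebra.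
From mathcomp Require Import all_classical all_reals all_analysis measurable_realfun.
From mathcomp Require Import ring lra.
Set Implicit Arguments.
Unset Strict Implicit.
Unset Printing Implicit Defensive.
Import Order.TTheory GRing.Theory Num.Theory.
Local Open Scope classical_set_scope.
Local Open Scope ring_scope.

(** * Integrals: monotonicity, measurability in a parameter, shifted second moments *)

(** The integral of a nonnegative function is a supremum over the simple functions below it, and
    there are more of these below [f2] than below [f1]. Iterated integrals can thus be compared
    without first showing their inner integrals measurable. *)
Lemma le_ge0_integral d (T : measurableType d) (R : realType)
    (mu : {measure set T -> \bar R}) (f1 f2 : T -> \bar R) :
  (forall x, 0 <= f1 x)%E -> (forall x, f1 x <= f2 x)%E ->
  (\int[mu]_x f1 x <= \int[mu]_x f2 x)%E.
Proof.
move=> f10 f12; have f20 x : (0 <= f2 x)%E by exact: le_trans (f10 x) (f12 x).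
rewrite !ge0_integralTE//; apply: le_ereal_sup => _ [h hf1 <-].
by exists h => // x; exact: le_trans (hf1 x) (f12 x).
Qed.

Lemma integral_probability_cst d (T : measurableType d) (R : realType)
    (P : probability T R) (c : \bar R) : (\int[P]_x c = c)%E.
Proof.
rewrite integral_cst// -[RHS]mule1; congr (_ * _)%E; exact: probability_setT.
Qed.

(* [f^-1 = f `^ (-1)] also where [f] vanishes. *)
Lemma measurable_inv_ge0 d (T : measurableType d) (R : realType) (f : T -> R) :
  (forall x, 0 <= f x) -> measurable_fun setT f ->
  measurable_fun setT (fun x => (f x)^-1).
Proof.
move=> f0 mf; under eq_fun do rewrite -(powR_inv1 (f0 _)).
exact: (measurableT_comp (measurable_powR (-1)) mf).
Qed.

(** Tonelli applies to the positive and the negative part of [f] separately. Signed integrands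
    matter here because [ipA] integrates them. *)
Lemma measurable_fun_integral_param d1 d2 (T1 : measurableType d1)
    (T2 : measurableType d2) (R : realType)
    (mu : {sigma_finite_measure set T2 -> \bar R}) (f : T1 * T2 -> \bar R) :
  measurable_fun setT f -> measurable_fun setT (fun x => \int[mu]_y f (x, y))%E.
Proof.
move=> mf; have -> : (fun x => \int[mu]_y f (x, y))%E =
    (fun x => \int[mu]_y f^\+ (x, y) - \int[mu]_y f^\- (x, y))%E.
  apply/funext => x; rewrite integralE.
  by congr (_ - _)%E; apply: eq_integral => y _; rewrite ?funeposE ?funenegE.
apply: emeasurable_funB.
- exact: (measurable_fun_fubini_tonelli_F (m2 := mu) _
    (measurable_funepos mf) (@funepos_ge0 _ _ _)).
- exact: (measurable_fun_fubini_tonelli_F (m2 := mu) _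
    (measurable_funeneg mf) (@funeneg_ge0 _ _ _)).
Qed.

Lemma measurable_fun_integral_ker d1 d2 (T1 : measurableType d1)
    (T2 : measurableType d2) (R : realType)
    (k : R.-pker T1 ~> T2) (f : T1 * T2 -> \bar R) :
  measurable_fun setT f -> measurable_fun setT (fun x => \int[k x]_y f (x, y))%E.
Proof.
move=> mf; have -> : (fun x => \int[k x]_y f (x, y))%E =
    (fun x => \int[k x]_y f^\+ (x, y) - \int[k x]_y f^\- (x, y))%E.
  apply/funext => x; rewrite integralE.
  by congr (_ - _)%E; apply: eq_integral => y _; rewrite ?funeposE ?funenegE.
apply: emeasurable_funB.
- exact: (measurable_fun_integral_finite_kernel _ k
    (@funepos_ge0 _ _ _) (measurable_funepos mf)).
- exact: (measurable_fun_integral_finite_kernel _ k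
    (@funeneg_ge0 _ _ _) (measurable_funeneg mf)).
Qed.

(** For a probability density [w], expand the square and integrate term by term: the cross term
    gives [2 * m * c], and the constant has total weight 1. If the second moment of [f] is infinite,
    so is the right-hand side. The outcome, the action and the context are each integrated out with
    this lemma, with weights 1, [p] and 1. *)
Lemma le_integral_sqr_shift d (T : measurableType d) (R : realType)
    (mu : {measure set T -> \bar R}) (w f : T -> R) (m c : R) :
  measurable_fun setT w -> measurable_fun setT f -> (forall x, 0 <= w x) ->
  (\int[mu]_x (w x)%:E = 1)%E ->
  mu.-integrable setT (fun x => (w x * f x)%:E) ->
  (\int[mu]_x (w x * f x)%:E = m%:E)%E ->
  (\int[mu]_x (w x * (f x + c) ^+ 2)%:E
    <= \int[mu]_x (w x * f x ^+ 2)%:E + (2 * m * c + c ^+ 2)%:E)%E.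
Proof.
move=> mw mf w0 w1 iwf wfm.
have wf0 x : (0 <= (w x * f x ^+ 2)%:E)%E.
  by rewrite lee_fin mulr_ge0// sqr_ge0.
have mwf : measurable_fun setT (fun x => (w x * f x ^+ 2)%:E).
  by apply/measurable_EFinP; apply: measurable_funM => //; exact: measurable_funX.
have [fin|inf] := ltP (\int[mu]_x (w x * f x ^+ 2)%:E)%E +oo%E; last first.
  by move: inf; rewrite leye_eq => /eqP ->; rewrite addye// leey.
have iw : mu.-integrable setT (fun x => (w x)%:E).
  apply/integrableP; split; first exact/measurable_EFinP.
  under eq_integral do rewrite gee0_abs ?lee_fin//.
  by rewrite w1 ltry.
have iwf2 : mu.-integrable setT (fun x => (w x * f x ^+ 2)%:E).
  apply/integrableP; split => //.
  by under eq_integral do rewrite gee0_abs//.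
rewrite (eq_integral (fun x => (w x * f x ^+ 2)%:E +
    ((2 * c)%:E * (w x * f x)%:E + (c ^+ 2)%:E * (w x)%:E))%E); last first.
  by move=> x _; rewrite -!EFinM -!EFinD; congr EFin; ring.
have i1 : mu.-integrable setT (fun x => (2 * c)%:E * (w x * f x)%:E)%E.
  exact: integrableZl.
have i2 : mu.-integrable setT (fun x => (c ^+ 2)%:E * (w x)%:E)%E.
  exact: integrableZl.
rewrite integralD//; last exact: integrableD.
rewrite integralD// !integralZl// wfm w1 mule1 leeD2l//.
by rewrite -EFinM -EFinD lee_fin le_eqVlt; apply/orP; left; apply/eqP; ring.
Qed.

(** * One step at a fixed history: integrating out outcome, action and context *)

Section ConditionalSecondMoment.
Context {R : realType} {dX dA : measure_display}
  {TX : measurableType dX} {TA : measurableType dA}.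
Variable Gam : R.-pker (TX * TA) ~> R.

Lemma measurable_mustar :
  measurable_fun setT (fun z : TX * TA => mustar Gam z.1 z.2).
Proof.
have -> : (fun z : TX * TA => mustar Gam z.1 z.2) =
    fine \o (fun z => \int[Gam z]_y y%:E)%E by apply/funext => -[].
apply: measurableT_comp; first exact: fine_measurable.
have /(measurable_fun_integral_ker Gam) : measurable_fun setT
    (fun zy : TX * TA * R => zy.2%:E) by exact/measurable_EFinP.
exact.
Qed.

Lemma measurable_sigma2 :
  measurable_fun setT (fun z : TX * TA => sigma2 Gam z.1 z.2).
Proof.
have -> : (fun z : TX * TA => sigma2 Gam z.1 z.2) = fine \o
    (fun z => \int[Gam z]_y ((y - mustar Gam z.1 z.2) ^+ 2)%:E)%E.
  by apply/funext => -[].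
apply: measurableT_comp; first exact: fine_measurable.
have /(measurable_fun_integral_ker Gam) : measurable_fun setT
    (fun zy : TX * TA * R => ((zy.2 - mustar Gam zy.1.1 zy.1.2) ^+ 2)%:E).
  apply/measurable_EFinP; apply: measurable_funX; apply: measurable_funB => //.
  exact: (measurableT_comp measurable_mustar measurable_fst).
exact.
Qed.

Lemma sigma2_ge0 x a : 0 <= sigma2 Gam x a.
Proof.
by apply: fine_ge0; apply: integral_ge0 => y _; rewrite lee_fin sqr_ge0.
Qed.

Hypothesis Gam_sqr : forall x a,
  (Gam (x, a)).-integrable setT (fun y : R => (y ^+ 2)%:E).

Lemma integrable_ker_cst x a (c : R) :
  (Gam (x, a)).-integrable setT (fun _ : R => c%:E).
Proof.
apply/integrableP; split => //.
by rewrite integral_cst// prob_kernel mule1 ltry.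
Qed.

Lemma integrable_ker_id x a :
  (Gam (x, a)).-integrable setT (fun y : R => y%:E).
Proof.
(* Domination by [1 + y ^+ 2]: expanding the square of [|y| - 1] gives [2 * |y| <= 1 + y ^+ 2]. *)
apply: (@le_integrable _ _ _ _ _ measurableT _ (fun y : R => (1 + y ^+ 2)%:E)).
- exact/measurable_EFinP.
- move=> y _; rewrite !abse_EFin lee_fin [leRHS]ger0_norm ?addr_ge0 ?sqr_ge0//.
  rewrite -(real_normK (num_real y)); have := sqr_ge0 (`|y| - 1).
  by have := normr_ge0 y; nra.
- under eq_fun do rewrite EFinD.
  by apply: integrableD => //; exact: integrable_ker_cst.
Qed.

(** [fine] sends infinite values to 0, so [mustar] is the true mean only because the second moment
    makes the integral finite. The next lemma does the same for [sigma2]. *)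
Lemma integral_ker_id x a :
  (\int[Gam (x, a)]_y y%:E = (mustar Gam x a)%:E)%E.
Proof.
rewrite /mustar fineK//; apply: integrable_fin_num => //.
exact: integrable_ker_id.
Qed.

Lemma integral_ker_sqr x a :
  (\int[Gam (x, a)]_y ((y - mustar Gam x a) ^+ 2)%:E = (sigma2 Gam x a)%:E)%E.
Proof.
rewrite /sigma2 fineK//; apply: integrable_fin_num => //.
set m := mustar _ _ _.
have -> : (fun y : R => ((y - m) ^+ 2)%:E) =
    (fun y : R => (y ^+ 2)%:E + ((- (2 * m))%:E * y%:E + (m ^+ 2)%:E))%E.
  by apply/funext => y; rewrite -EFinM -!EFinD; congr EFin; ring.
apply: integrableD => //; apply: integrableD => //.
  by apply: integrableZl => //; exact: integrable_ker_id.
exact: integrable_ker_cst.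
Qed.

(** Integrates out the outcome, with [m] in the role of the estimate of the mean. Recentring at the
    true mean [mu] turns the integrand into the square of [b * (y - mu) + c], where [c] is the mean
    of the whole expression. The first summand has mean 0 and variance [b ^+ 2 * sigma2 Gam x a]. *)
Lemma le_integral_ker_sqr_shift x a (b m e : R) :
  (\int[Gam (x, a)]_y ((b * (y - m) + e) ^+ 2)%:E <=
   (b ^+ 2 * sigma2 Gam x a + (b * (mustar Gam x a - m) + e) ^+ 2)%:E)%E.
Proof.
set mu := mustar Gam x a; set c := b * (mu - m) + e.
have ift : (Gam (x, a)).-integrable setT (fun y : R => b%:E * (y%:E - mu%:E))%E.
  apply: integrableZl => //; apply: integrableB => //.
    exact: integrable_ker_id.
  exact: integrable_ker_cst.
have eft : (fun y : R => b%:E * (y%:E - mu%:E))%E =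
    (fun y : R => (1 * (b * (y - mu)))%:E) by apply/funext => y; rewrite mul1r.
have -> : (\int[Gam (x, a)]_y ((b * (y - m) + e) ^+ 2)%:E =
    \int[Gam (x, a)]_y (1 * (b * (y - mu) + c) ^+ 2)%:E)%E.
  by apply: eq_integral => y _; congr EFin; rewrite /c; ring.
(* The vanishing cross term [2 * 0 * c] is written out so as to match [le_integral_sqr_shift] with
   mean 0. *)
have -> : ((b ^+ 2 * sigma2 Gam x a + c ^+ 2)%:E =
    \int[Gam (x, a)]_y (1 * (b * (y - mu)) ^+ 2)%:E +
    (2 * 0 * c + c ^+ 2)%:E)%E.
  rewrite mulr0 mul0r add0r EFinD EFinM -integral_ker_sqr.
  rewrite -ge0_integralZl_EFin ?sqr_ge0//.
  - congr (_ + _)%E.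
    by apply: eq_integral => y _; rewrite -EFinM mul1r exprMn.
  - by move=> y _; rewrite lee_fin sqr_ge0.
  - by apply/measurable_EFinP; apply: measurable_funX; exact: measurable_funB.
apply: (@le_integral_sqr_shift _ _ _ (Gam (x, a)) (fun _ : R => 1)
  (fun y : R => b * (y - mu)) 0 c) => //.
- by apply: measurable_funM => //; exact: measurable_funB.
- by rewrite integral_cst// prob_kernel mule1.
- by rewrite -eft.
- rewrite -eft integralZl//; last first.
    by apply: integrableB => //; [exact: integrable_ker_id|exact: integrable_ker_cst].
  rewrite integralB//; [|exact: integrable_ker_id|exact: integrable_ker_cst].
  by rewrite integral_ker_id integral_cst// prob_kernel mule1 subee// mule0.
Qed.

Variables (lamA : {sigma_finite_measure set TA -> \bar R}).
Variable g : TX -> TA -> R.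
Hypothesis mg : measurable_fun setT (fun z : TX * TA => g z.1 z.2).
Hypothesis gmu_int : forall x,
  lamA.-integrable setT (fun a => (g x a * mustar Gam x a)%:E).

(** The map [r] extracts the context from the parameter: it is the identity for [mustar], and the
    second projection for an estimate that depends on history and context. *)
Lemma measurable_ipA d (T : measurableType d) (r : T -> TX) (f : T -> TA -> R) :
  measurable_fun setT r ->
  measurable_fun setT (fun z : T * TA => f z.1 z.2) ->
  measurable_fun setT (fun t => ipA lamA (g (r t)) (f t)).
Proof.
move=> mr mf; apply: measurableT_comp; first exact: fine_measurable.
have /(measurable_fun_integral_param lamA) : measurable_fun setT
    (fun z : T * TA => (g (r z.1) z.2 * f z.1 z.2)%:E).
  apply/measurable_EFinP; apply: measurable_funM => //.
  apply: (measurableT_comp mg (g := fun z : T * TA => (r z.1, z.2))).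
  by apply: measurable_fun_pair => //; exact: measurableT_comp.
exact.
Qed.

(** Integrates out the action. By importance weighting, the weighted error [q] has mean [M - N]
    under the density [p], the difference of the inner products of [g x] with the true and the
    estimated effect. The variance of [q] is then bounded by its second moment, which is the error
    term of the theorem. *)
Lemma le_integral_action x (p mh : TA -> R) (k : R) :
  measurable_fun setT p -> (forall a, 0 <= p a) ->
  (\int[lamA]_a (p a)%:E = 1)%E -> (forall a, g x a != 0 -> 0 < p a) ->
  measurable_fun setT mh ->
  lamA.-integrable setT (fun a => (g x a * mh a)%:E) ->
  (\int[lamA]_a ((p a)%:E * ((g x a / p a) ^+ 2 * sigma2 Gam x a +
      (g x a / p a * (mustar Gam x a - mh a) + k) ^+ 2)%:E) <=
   \int[lamA]_a ((p a)%:E * (g x a ^+ 2 * sigma2 Gam x a / p a ^+ 2)%:E) +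
   \int[lamA]_a ((p a)%:E *
     (g x a ^+ 2 * (mh a - mustar Gam x a) ^+ 2 / p a ^+ 2)%:E) +
   ((ipA lamA (g x) (mustar Gam x) - ipA lamA (g x) mh + k) ^+ 2)%:E)%E.
Proof.
move=> mp p0 p1 gp mmh gmh_int.
have mpr : measurable_fun setT (fun a : TA => (x, a)) by exact: measurable_fun_pair.
have mgx : measurable_fun setT (g x) by exact: (measurableT_comp mg mpr).
have mmu : measurable_fun setT (mustar Gam x).
  exact: (measurableT_comp measurable_mustar mpr).
have msi : measurable_fun setT (sigma2 Gam x).
  exact: (measurableT_comp measurable_sigma2 mpr).
have mb : measurable_fun setT (fun a => g x a / p a).
  by apply: measurable_funM => //; exact: measurable_inv_ge0.
set q := fun a => g x a / p a * (mustar Gam x a - mh a).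
have mq : measurable_fun setT q.
  by apply: measurable_funM => //; exact: measurable_funB.
(* Where [g x a] is nonzero, overlap makes [p a] positive and it cancels; elsewhere both sides are 0
   whatever [p a] is. *)
have pq : (fun a => (p a * q a)%:E) =
    (fun a => (g x a * mustar Gam x a)%:E - (g x a * mh a)%:E)%E.
  apply/funext => a; rewrite -EFinB /q; congr EFin.
  have [->|/gp pa] := eqVneq (g x a) 0; first by ring.
  by field; rewrite gt_eqF.
set M := ipA lamA (g x) (mustar Gam x); set N := ipA lamA (g x) mh.
have ME : (\int[lamA]_a (g x a * mustar Gam x a)%:E = M%:E)%E.
  by rewrite /M /ipA fineK//; exact: integrable_fin_num.
have NE : (\int[lamA]_a (g x a * mh a)%:E = N%:E)%E.
  by rewrite /N /ipA fineK//; exact: integrable_fin_num.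
have le_shift : (\int[lamA]_a (p a * (q a + k) ^+ 2)%:E <=
    \int[lamA]_a (p a * q a ^+ 2)%:E + ((M - N + k) ^+ 2)%:E)%E.
  apply: le_trans (le_integral_sqr_shift (m := M - N) k mp mq p0 p1 _ _) _.
  - by rewrite pq; exact: integrableB.
  - by rewrite pq integralB// ME NE.
  (* the square of the mean [M - N] of [q] is dropped *)
  - by rewrite leeD2l// lee_fin; have := sqr_ge0 (M - N); nra.
under eq_integral do rewrite EFinD muleDr//.
rewrite ge0_integralD//=; first last.
- by apply/measurable_EFinP; apply: measurable_funM => //;
    apply: measurable_funX; exact: measurable_funD.
- by move=> a _; rewrite lee_fin mulr_ge0// sqr_ge0.
- by apply/measurable_EFinP; apply: measurable_funM => //;
    apply: measurable_funM => //; exact: measurable_funX.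
- by move=> a _; rewrite lee_fin mulr_ge0// mulr_ge0 ?sqr_ge0 ?sigma2_ge0.
rewrite -[leRHS]addeA; apply: leeD.
  rewrite le_eqVlt; apply/orP; left; apply/eqP; apply: eq_integral => a _.
  by congr (_ * _%:E)%E; rewrite expr_div_n mulrAC.
apply: le_trans le_shift _; rewrite leeD2r//.
rewrite le_eqVlt; apply/orP; left; apply/eqP; apply: eq_integral => a _.
by rewrite -EFinM /q !exprMn exprVn -(sqrrN (mh a - _)) opprB mulrAC.
Qed.

Variable Xi : probability TX R.
Hypothesis ip_int :
  Xi.-integrable setT (fun x => (ipA lamA (g x) (mustar Gam x))%:E).

(** Integrates out the context; [s] stands for the sum of the past centred scores, a constant given
    the history. After the action step the inner product with the estimate [mh] has cancelled,
    leaving the square of [ipA lamA (g x) (mustar Gam x) - tau + s]. Its unshifted part has mean 0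
    under [Xi], so the square splits into [var_gmu] and [s ^+ 2]. *)
Lemma le_integral_context_action (p mh : TX -> TA -> R) (s : R) :
  measurable_fun setT (fun z : TX * TA => p z.1 z.2) ->
  (forall x a, 0 <= p x a) ->
  (forall x, \int[lamA]_a (p x a)%:E = 1)%E ->
  (forall x a, g x a != 0 -> 0 < p x a) ->
  measurable_fun setT (fun z : TX * TA => mh z.1 z.2) ->
  (forall x, lamA.-integrable setT (fun a => (g x a * mh x a)%:E)) ->
  (\int[Xi]_x \int[lamA]_a ((p x a)%:E * \int[Gam (x, a)]_y
      ((s + (g x a / p x a * (y - mh x a) + ipA lamA (g x) (mh x)
        - tau_star Xi lamA Gam g)) ^+ 2)%:E) <=
   \int[Xi]_x \int[lamA]_a ((p x a)%:E *
     (g x a ^+ 2 * sigma2 Gam x a / p x a ^+ 2)%:E) +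
   \int[Xi]_x \int[lamA]_a ((p x a)%:E *
     (g x a ^+ 2 * (mh x a - mustar Gam x a) ^+ 2 / p x a ^+ 2)%:E) +
   (var_gmu Xi lamA Gam g + (s ^+ 2)%:E))%E.
Proof.
move=> mp p0 p1 gp mmh gmh_int; set tau := tau_star _ _ _ _.
have mpr (x : TX) : measurable_fun setT (fun a : TA => (x, a)).
  exact: measurable_fun_pair.
have mip : measurable_fun setT (fun x => ipA lamA (g x) (mustar Gam x)).
  exact: (@measurable_ipA _ TX id (mustar Gam) (@measurable_id _ _ _)
    measurable_mustar).
have mpV : measurable_fun setT (fun z : TX * TA => (p z.1 z.2 ^+ 2)^-1).
  apply: measurable_inv_ge0 => [z|]; first exact: sqr_ge0.
  exact: measurable_funX.
set S := fun x => (\int[lamA]_a ((p x a)%:E *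
     (g x a ^+ 2 * sigma2 Gam x a / p x a ^+ 2)%:E))%E.
set E := fun x => (\int[lamA]_a ((p x a)%:E *
     (g x a ^+ 2 * (mh x a - mustar Gam x a) ^+ 2 / p x a ^+ 2)%:E))%E.
set V := fun x => ((ipA lamA (g x) (mustar Gam x) - tau + s) ^+ 2)%:E.
have S0 x : (0 <= S x)%E.
  apply: integral_ge0 => a _; rewrite -EFinM lee_fin mulr_ge0// mulr_ge0//.
    by rewrite mulr_ge0 ?sqr_ge0 ?sigma2_ge0.
  by rewrite invr_ge0 sqr_ge0.
have E0 x : (0 <= E x)%E.
  apply: integral_ge0 => a _; rewrite -EFinM lee_fin mulr_ge0// mulr_ge0//.
    by rewrite mulr_ge0 ?sqr_ge0.
  by rewrite invr_ge0 sqr_ge0.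
have mS : measurable_fun setT S.
  have /(measurable_fun_integral_param lamA) : measurable_fun setT
      (fun z : TX * TA => (p z.1 z.2)%:E *
        (g z.1 z.2 ^+ 2 * sigma2 Gam z.1 z.2 / p z.1 z.2 ^+ 2)%:E)%E.
    apply/measurable_EFinP; apply: measurable_funM => //.
    apply: measurable_funM => //; apply: measurable_funM.
      exact: measurable_funX.
    exact: measurable_sigma2.
  exact.
have mE : measurable_fun setT E.
  have /(measurable_fun_integral_param lamA) : measurable_fun setT
      (fun z : TX * TA => (p z.1 z.2)%:E * (g z.1 z.2 ^+ 2 *
        (mh z.1 z.2 - mustar Gam z.1 z.2) ^+ 2 / p z.1 z.2 ^+ 2)%:E)%E.
    apply/measurable_EFinP; apply: measurable_funM => //.
    apply: measurable_funM => //; apply: measurable_funM.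
      exact: measurable_funX.
    by apply: measurable_funX; apply: measurable_funB => //; exact: measurable_mustar.
  exact.
have mV : measurable_fun setT V.
  apply/measurable_EFinP; apply: measurable_funX; apply: measurable_funD => //.
  exact: measurable_funB.
apply: (@le_trans _ _ (\int[Xi]_x (S x + E x + V x))%E).
  apply: le_ge0_integral => x.
    apply: integral_ge0 => a _; apply: mule_ge0; first by rewrite lee_fin.
    by apply: integral_ge0 => y _; rewrite lee_fin sqr_ge0.
  set N := ipA lamA (g x) (mh x).
  (* Outcome step inside the action integral, with [b] the importance ratio, [m] the estimate and
     [e = N - tau + s]. The same [N - tau + s] is then the constant [k] of the action step. *)
  apply: (@le_trans _ _ (\int[lamA]_a ((p x a)%:E *
      ((g x a / p x a) ^+ 2 * sigma2 Gam x a +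
      (g x a / p x a * (mustar Gam x a - mh x a) + (N - tau + s)) ^+ 2)%:E))%E).
    apply: le_ge0_integral => a.
      apply: mule_ge0; first by rewrite lee_fin.
      by apply: integral_ge0 => y _; rewrite lee_fin sqr_ge0.
    apply: lee_wpmul2l; first by rewrite lee_fin.
    apply: le_trans (le_integral_ker_sqr_shift _ _ _ _ _).
    rewrite le_eqVlt; apply/orP; left; apply/eqP; apply: eq_integral => y _.
    by congr EFin; ring.
  have := @le_integral_action x (p x) (mh x) (N - tau + s).
  move=> /(_ (measurableT_comp mp (mpr x)) (p0 x) (p1 x) (gp x)
    (measurableT_comp mmh (mpr x)) (gmh_int x)) => /le_trans; apply.
  rewrite -/(S x) -/(E x) leeD2l// /V lee_fin le_eqVlt; apply/orP; left; apply/eqP.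
  by rewrite -/N; ring.
rewrite ge0_integralD//; first last.
- by move=> x _; rewrite lee_fin sqr_ge0.
- exact: emeasurable_funD.
- by move=> x _; rewrite adde_ge0.
rewrite ge0_integralD// leeD2l//.
(* Only the context is left: [tau] is the mean of the inner product, so the shift lemma applies with
   weight 1 and mean 0. *)
have tauE : (\int[Xi]_x (ipA lamA (g x) (mustar Gam x))%:E = tau%:E)%E.
  by rewrite /tau /tau_star fineK//; exact: integrable_fin_num.
have icst : Xi.-integrable setT (fun=> tau%:E).
  exact: (finite_measure_integrable_cst Xi tau measurableT).
have ef : (fun x => (ipA lamA (g x) (mustar Gam x))%:E - tau%:E)%E =
    (fun x => (1 * (ipA lamA (g x) (mustar Gam x) - tau))%:E).
  by apply/funext => x; rewrite mul1r.
have -> : (\int[Xi]_x V x = \int[Xi]_x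
    (1 * (ipA lamA (g x) (mustar Gam x) - tau + s) ^+ 2)%:E)%E.
  by apply: eq_integral => x _; rewrite mul1r.
have -> : (var_gmu Xi lamA Gam g + (s ^+ 2)%:E = \int[Xi]_x
    (1 * (ipA lamA (g x) (mustar Gam x) - tau) ^+ 2)%:E +
    (2 * 0 * s + s ^+ 2)%:E)%E.
  rewrite mulr0 mul0r add0r; congr (_ + _)%E.
  by apply: eq_integral => x _; rewrite mul1r.
apply: (@le_integral_sqr_shift _ _ _ Xi (fun=> 1)
  (fun x => ipA lamA (g x) (mustar Gam x) - tau) 0 s) => //.
- exact: measurable_funB.
- exact: integral_probability_cst.
- by rewrite -ef; exact: integrableB.
- by rewrite -ef integralB// tauE integral_probability_cst subee.
Qed.

End ConditionalSecondMoment.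

(** * Prefixes of histories and sums of integrals *)

(** Recovers an earlier history from a later one, so that the sum of all past scores is a function
    of the latest history alone. *)
Definition prefix_tuple (T : Type) j (h : j.-tuple T) (i : 'I_j) : i.-tuple T :=
  [tuple tnth h (widen_ord (ltnW (ltn_ord i)) k) | k < i].

Lemma measurable_prefix_tuple d (T : measurableType d) j (i : 'I_j) :
  measurable_fun setT (fun h : j.-tuple T => prefix_tuple h i).
Proof.
apply/measurable_fun_tnthP => k.
rewrite (_ : _ \o _ = fun h => tnth h (widen_ord (ltnW (ltn_ord i)) k)).
  exact: measurable_tnth.
by apply/funext => h /=; rewrite tnth_mktuple.
Qed.

Lemma integral_probabilityD4 d (T : measurableType d) (R : realType)
    (P : probability T R) (v : \bar R) (f1 f2 f3 : T -> \bar R) :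
  (0 <= v)%E ->
  (forall x, 0 <= f1 x)%E -> measurable_fun setT f1 ->
  (forall x, 0 <= f2 x)%E -> measurable_fun setT f2 ->
  (forall x, 0 <= f3 x)%E -> measurable_fun setT f3 ->
  (\int[P]_x (f1 x + f2 x + (v + f3 x)) =
   \int[P]_x f3 x + (v + \int[P]_x f1 x + \int[P]_x f2 x))%E.
Proof.
move=> v0 f10 mf1 f20 mf2 f30 mf3.
rewrite ge0_integralD//; first last.
- exact: emeasurable_funD.
- by move=> x _; rewrite adde_ge0.
- exact: emeasurable_funD.
- by move=> x _; rewrite adde_ge0.
rewrite ge0_integralD// ge0_integralD// integral_probability_cst.
move: (\int[P]_x f1 x)%E (\int[P]_x f2 x)%E (\int[P]_x f3 x)%E => a b c.
by rewrite [LHS]addeC -!addeA addeCA.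
Qed.

(** * Sequential data: accumulating the centred scores *)

Section SequentialData.
Context {R : realType} {dX dA dO : measure_display}
  {TX : measurableType dX} {TA : measurableType dA} {Omega : measurableType dO}.
Variables (P : probability Omega R)
  (lamA : {sigma_finite_measure set TA -> \bar R}) (Xi : probability TX R)
  (Gam : R.-pker (TX * TA) ~> R) (g : TX -> TA -> R) (n : nat)
  (pi : forall i : nat, i.-tuple (obs R TX TA) -> TX -> TA -> R)
  (muhat : forall i : nat, i.-tuple (obs R TX TA) -> TX -> TA -> R)
  (Ob : nat -> Omega -> obs R TX TA).
Arguments pi : clear implicits.
Arguments muhat : clear implicits.
Hypothesis mg : measurable_fun setT (fun z : TX * TA => g z.1 z.2).
Hypothesis mpi : forall i : nat, measurable_fun setT
  (fun z : i.-tuple (obs R TX TA) * TX * TA => pi i z.1.1 z.1.2 z.2).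
Hypothesis pi_ge0 : forall i h x a, 0 <= pi i h x a.
Hypothesis pi_int : forall i h x, (\int[lamA]_a ((pi i h x a)%:E) = 1)%E.
Hypothesis pi_gt0 : forall i h x a, g x a != 0 -> 0 < pi i h x a.
Hypothesis mmuhat : forall i : nat, measurable_fun setT
  (fun z : i.-tuple (obs R TX TA) * TX * TA => muhat i z.1.1 z.1.2 z.2).
Hypothesis Gam_sqr : forall x a,
  (Gam (x, a)).-integrable setT (fun y : R => (y ^+ 2)%:E).
Hypothesis gmu_int : forall x,
  lamA.-integrable setT (fun a => (g x a * mustar Gam x a)%:E).
Hypothesis gmuhat_int : forall i h x,
  lamA.-integrable setT (fun a => (g x a * muhat i h x a)%:E).
Hypothesis ip_int :
  Xi.-integrable setT (fun x => (ipA lamA (g x) (mustar Gam x))%:E).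
Hypothesis mOb : forall i, (i < n)%N -> measurable_fun setT (Ob i).
Hypothesis Ob_law : forall i : nat, (i < n)%N ->
  forall F : i.-tuple (obs R TX TA) * (obs R TX TA) -> \bar R,
  measurable_fun setT F -> (forall z, 0 <= F z)%E ->
  (\int[P]_w F (hist Ob i w, Ob i w)
   = \int[P]_w \int[Xi]_x \int[lamA]_a
       ((pi i (hist Ob i w) x a)%:E *
        \int[Gam (x, a)]_y F (hist Ob i w, (x, a, y))))%E.

(** The AIPW score minus its target, as a function of the history and the new observation rather
    than of the sample point: this is the form to which [Ob_law] applies. *)
Definition score_dev i (h : i.-tuple (obs R TX TA)) (o : obs R TX TA) : R :=
  g o.1.1 o.1.2 / pi i h o.1.1 o.1.2 * (o.2 - muhat i h o.1.1 o.1.2)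
    + ipA lamA (g o.1.1) (muhat i h o.1.1) - tau_star Xi lamA Gam g.

Definition score_dev_sum j (h : j.-tuple (obs R TX TA)) : R :=
  \sum_(i < j) score_dev (prefix_tuple h i) (tnth h i).

Lemma score_dev_sum_hist j w :
  score_dev_sum (hist Ob j w) = \sum_(i < j) score_dev (hist Ob i w) (Ob i w).
Proof.
apply: eq_bigr => i _; congr score_dev; last by rewrite tnth_mktuple.
by apply: eq_from_tnth => k; rewrite !tnth_mktuple.
Qed.

Lemma measurable_hist j : (j <= n)%N -> measurable_fun setT (hist Ob j).
Proof.
move=> jn; apply/measurable_fun_tnthP => k.
rewrite (_ : _ \o _ = Ob k); first by apply: mOb; exact: leq_trans jn.
by apply/funext => w /=; rewrite tnth_mktuple.
Qed.

Lemma measurable_score_dev i : measurable_fun setT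
  (fun z : i.-tuple (obs R TX TA) * obs R TX TA => score_dev z.1 z.2).
Proof.
pose Z := (i.-tuple (obs R TX TA) * obs R TX TA)%type.
have mx : measurable_fun setT (fun z : Z => z.2.1.1).
  by do 2 apply: measurableT_comp => //.
have ma : measurable_fun setT (fun z : Z => z.2.1.2).
  by do 2 apply: measurableT_comp => //.
have mhx : measurable_fun setT (fun z : Z => (z.1, z.2.1.1)).
  exact: measurable_fun_pair.
have mxa : measurable_fun setT (fun z : Z => (z.2.1.1, z.2.1.2)).
  exact: measurable_fun_pair.
have mhxa : measurable_fun setT (fun z : Z => (z.1, z.2.1.1, z.2.1.2)).
  exact: measurable_fun_pair.
apply: measurable_funB => //; apply: measurable_funD.
  apply: measurable_funM.
    apply: measurable_funM; first exact: (measurableT_comp mg mxa).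
    apply: measurable_inv_ge0 => //.
    exact: (measurableT_comp (@mpi i) mhxa).
  apply: measurable_funB; first exact: measurableT_comp.
  exact: (measurableT_comp (@mmuhat i) mhxa).
have mip : measurable_fun setT (fun t : i.-tuple (obs R TX TA) * TX =>
    ipA lamA (g t.2) (muhat i t.1 t.2)).
  exact: (@measurable_ipA _ _ _ _ _ lamA g mg _ _ snd
    (fun t : i.-tuple (obs R TX TA) * TX => muhat i t.1 t.2)
    measurable_snd (@mmuhat i)).
exact: (measurableT_comp mip mhx).
Qed.

Lemma measurable_score_dev_sum j :
  measurable_fun setT (@score_dev_sum j).
Proof.
apply: measurable_sum => i.
have mp : measurable_fun setT (fun h : j.-tuple (obs R TX TA) =>
    (prefix_tuple h i, tnth h i)).
  apply: measurable_fun_pair; first exact: measurable_prefix_tuple.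
  exact: measurable_tnth.
by have := measurableT_comp (@measurable_score_dev i) mp.
Qed.

(** [phi] does not involve the outcome, so the innermost integral in [Ob_law] is that of a constant
    against a probability. This links the expectations in the theorem with the iterated integrals of
    the one-step bound. *)
Lemma integral_weighted (i : nat) (phi : TX -> TA -> i.-tuple (obs R TX TA) -> R) :
  (i < n)%N ->
  measurable_fun setT (fun z : i.-tuple (obs R TX TA) * TX * TA =>
     phi z.1.2 z.2 z.1.1) ->
  (forall x a h, 0 <= phi x a h) ->
  (\int[P]_w (phi (Ob i w).1.1 (Ob i w).1.2 (hist Ob i w))%:E =
   \int[P]_w \int[Xi]_x \int[lamA]_a
     ((pi i (hist Ob i w) x a)%:E * (phi x a (hist Ob i w))%:E))%E.
Proof.
move=> lin mphi phi0.
pose F (z : i.-tuple (obs R TX TA) * obs R TX TA) : \bar R :=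
  (phi z.2.1.1 z.2.1.2 z.1)%:E.
have mF : measurable_fun setT F.
  apply/measurable_EFinP.
  have mm : measurable_fun setT (fun z : i.-tuple (obs R TX TA) * obs R TX TA =>
      (z.1, z.2.1.1, z.2.1.2)).
    apply: measurable_fun_pair.
      by apply: measurable_fun_pair => //; do 2 apply: measurableT_comp => //.
    by do 2 apply: measurableT_comp => //.
  exact: (measurableT_comp mphi mm).
have F0 z : (0 <= F z)%E by rewrite lee_fin.
apply: eq_trans (Ob_law lin mF F0) _.
apply: eq_integral => w _; apply: eq_integral => x _; apply: eq_integral => a _.
by rewrite /F /= integral_cst// prob_kernel mule1.
Qed.

Lemma measurable_weighted (i : nat) (phi : TX -> TA -> i.-tuple (obs R TX TA) -> R) :
  (i < n)%N ->
  measurable_fun setT (fun z : i.-tuple (obs R TX TA) * TX * TA =>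
     phi z.1.2 z.2 z.1.1) ->
  measurable_fun setT (fun w => \int[Xi]_x \int[lamA]_a
     ((pi i (hist Ob i w) x a)%:E * (phi x a (hist Ob i w))%:E))%E.
Proof.
move=> lin mphi.
have mh := measurable_hist (ltnW lin).
have /(measurable_fun_integral_param lamA) mF : measurable_fun setT
    (fun z : i.-tuple (obs R TX TA) * TX * TA =>
      (pi i z.1.1 z.1.2 z.2)%:E * (phi z.1.2 z.2 z.1.1)%:E)%E.
  by apply/measurable_EFinP; apply: (measurable_funM (@mpi i)).
have mI := measurable_fun_integral_param Xi mF.
by have := measurableT_comp mI mh.
Qed.

Let sig i w := g (Ob i w).1.1 (Ob i w).1.2 ^+ 2 *
  sigma2 Gam (Ob i w).1.1 (Ob i w).1.2 /
  pi i (hist Ob i w) (Ob i w).1.1 (Ob i w).1.2 ^+ 2.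
Let err i w := g (Ob i w).1.1 (Ob i w).1.2 ^+ 2 *
  (muhat i (hist Ob i w) (Ob i w).1.1 (Ob i w).1.2 -
    mustar Gam (Ob i w).1.1 (Ob i w).1.2) ^+ 2 /
  pi i (hist Ob i w) (Ob i w).1.1 (Ob i w).1.2 ^+ 2.

(** [Ob_law] turns the left-hand side into an iterated integral in which the history is frozen;
    [le_integral_context_action] bounds it at each sample point with [s] the current sum, and the
    bound is integrated over [P]. *)
Lemma le_integral_score_dev_step j : (j < n)%N ->
  (\int[P]_w ((score_dev_sum (hist Ob j w) +
      score_dev (hist Ob j w) (Ob j w)) ^+ 2)%:E <=
   \int[P]_w (score_dev_sum (hist Ob j w) ^+ 2)%:E +
   (var_gmu Xi lamA Gam g + \int[P]_w (sig j w)%:E + \int[P]_w (err j w)%:E))%E.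
Proof.
move=> jn.
pose F (z : j.-tuple (obs R TX TA) * obs R TX TA) : \bar R :=
  ((score_dev_sum z.1 + score_dev z.1 z.2) ^+ 2)%:E.
have mF : measurable_fun setT F.
  apply/measurable_EFinP; apply: measurable_funX; apply: measurable_funD.
    exact: (measurableT_comp (@measurable_score_dev_sum j) measurable_fst).
  exact: measurable_score_dev.
have F0 z : (0 <= F z)%E by rewrite lee_fin sqr_ge0.
pose phis x a (h : j.-tuple (obs R TX TA)) :=
  g x a ^+ 2 * sigma2 Gam x a / pi j h x a ^+ 2.
pose phie x a (h : j.-tuple (obs R TX TA)) :=
  g x a ^+ 2 * (muhat j h x a - mustar Gam x a) ^+ 2 / pi j h x a ^+ 2.
have phis0 x a h : 0 <= phis x a h.
  by rewrite mulr_ge0 ?invr_ge0 ?sqr_ge0// mulr_ge0 ?sqr_ge0 ?sigma2_ge0.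
have phie0 x a h : 0 <= phie x a h.
  by rewrite mulr_ge0 ?invr_ge0 ?sqr_ge0// mulr_ge0 ?sqr_ge0.
pose Z := (j.-tuple (obs R TX TA) * TX * TA)%type.
have mxa : measurable_fun setT (fun z : Z => (z.1.2, z.2)).
  by apply: measurable_fun_pair => //; exact: measurableT_comp.
have mpV : measurable_fun setT (fun z : Z => (pi j z.1.1 z.1.2 z.2 ^+ 2)^-1).
  apply: measurable_inv_ge0 => [z|]; first exact: sqr_ge0.
  by apply: measurable_funX; exact: mpi.
have mg2 : measurable_fun setT (fun z : Z => g z.1.2 z.2 ^+ 2).
  by apply: measurable_funX; exact: (measurableT_comp mg mxa).
have mphis : measurable_fun setT (fun z : Z => phis z.1.2 z.2 z.1.1).
  apply: measurable_funM => //; apply: measurable_funM => //.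
  exact: (measurableT_comp (measurable_sigma2 Gam) mxa).
have mphie : measurable_fun setT (fun z : Z => phie z.1.2 z.2 z.1.1).
  apply: measurable_funM => //; apply: measurable_funM => //.
  apply: measurable_funX; apply: measurable_funB; first exact: mmuhat.
  exact: (measurableT_comp (measurable_mustar Gam) mxa).
have var0 : (0 <= var_gmu Xi lamA Gam g)%E.
  by apply: integral_ge0 => x _; rewrite lee_fin sqr_ge0.
(* The variance and error terms become integrals over [P] of functions of the history, ready to be
   compared sample point by sample point. *)
rewrite (integral_weighted jn mphis phis0) (integral_weighted jn mphie phie0).
have mS := measurable_weighted jn mphis.
have mE := measurable_weighted jn mphie.
set S := fun w => (\int[Xi]_x \int[lamA]_a
     ((pi j (hist Ob j w) x a)%:E * (phis x a (hist Ob j w))%:E))%E in mS *.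
set E := fun w => (\int[Xi]_x \int[lamA]_a
     ((pi j (hist Ob j w) x a)%:E * (phie x a (hist Ob j w))%:E))%E in mE *.
have S0 w : (0 <= S w)%E.
  apply: integral_ge0 => x _; apply: integral_ge0 => a _.
  by rewrite -EFinM lee_fin mulr_ge0.
have E0 w : (0 <= E w)%E.
  apply: integral_ge0 => x _; apply: integral_ge0 => a _.
  by rewrite -EFinM lee_fin mulr_ge0.
have mQ : measurable_fun setT (fun w => (score_dev_sum (hist Ob j w) ^+ 2)%:E).
  apply/measurable_EFinP; apply: measurable_funX.
  by have := measurableT_comp (@measurable_score_dev_sum j)
    (measurable_hist (ltnW jn)).
have Q0 w : (0 <= (score_dev_sum (hist Ob j w) ^+ 2)%:E)%E.
  by rewrite lee_fin sqr_ge0.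
(* The left-hand side is an instance of [F] up to conversion; it is replaced by the iterated
   integral from [Ob_law]. *)
refine (eq_ind_r (fun z => (z <= _)%E) _ (Ob_law jn mF F0)).
apply: (@le_trans _ _ (\int[P]_w (S w + E w +
    (var_gmu Xi lamA Gam g + (score_dev_sum (hist Ob j w) ^+ 2)%:E)))%E).
  apply: le_ge0_integral => w.
    apply: integral_ge0 => x _; apply: integral_ge0 => a _.
    by apply: mule_ge0; [rewrite lee_fin|exact: integral_ge0].
  have mhx : measurable_fun setT
      (fun z : TX * TA => (hist Ob j w, z.1, z.2)).
    by apply: measurable_fun_pair => //; exact: measurable_fun_pair.
  have mp : measurable_fun setT (fun z : TX * TA => pi j (hist Ob j w) z.1 z.2).
    exact: (measurableT_comp (@mpi j) mhx).
  have mm : measurable_fun setT (fun z : TX * TA => muhat j (hist Ob j w) z.1 z.2).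
    exact: (measurableT_comp (@mmuhat j) mhx).
  have step := le_integral_context_action Gam_sqr mg gmu_int ip_int
    (score_dev_sum (hist Ob j w)) mp (@pi_ge0 j (hist Ob j w))
    (@pi_int j (hist Ob j w)) (@pi_gt0 j (hist Ob j w)) mm (@gmuhat_int j (hist Ob j w)).
  exact: step.
by rewrite (integral_probabilityD4 P var0 S0 mS E0 mE Q0 mQ).
Qed.

(** Induction on [j] from the empty sum, each step adding one term. The bound [j <= n] keeps every
    step within the range where the law of the data is given. *)
Lemma le_integral_score_dev_sum j : (j <= n)%N ->
  (\int[P]_w (score_dev_sum (hist Ob j w) ^+ 2)%:E <=
   \sum_(i < j) (var_gmu Xi lamA Gam g + \int[P]_w (sig i w)%:E
     + \int[P]_w (err i w)%:E))%E.
Proof.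
elim: j => [_|j IH jn].
  rewrite big_ord0 (eq_integral (fun=> 0%:E)) ?integral_probability_cst//.
  by move=> w _; rewrite /score_dev_sum big_ord0 expr0n.
have -> : (\int[P]_w (score_dev_sum (hist Ob j.+1 w) ^+ 2)%:E =
    \int[P]_w ((score_dev_sum (hist Ob j w) +
      score_dev (hist Ob j w) (Ob j w)) ^+ 2)%:E)%E.
  apply: eq_integral => w _.
  by rewrite score_dev_sum_hist big_ord_recr/= -score_dev_sum_hist.
apply: le_trans (le_integral_score_dev_step jn) _.
by rewrite big_ord_recr/= leeD2r//; exact: IH (ltnW jn).
Qed.

End SequentialData.

(** * Normalization by the sample size and conclusion *)

(** One factor [n%:R^-1] is common to both sides; the other cancels the [n] copies of [v].
    Nonnegativity gives distributivity in the extended reals, where terms may be infinite. *)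
Lemma mean_sum_addE (R : realType) (n : nat) (v : \bar R) (a b : nat -> \bar R) :
  (0 < n)%N -> (0 <= v)%E -> (forall i, 0 <= a i)%E -> (forall i, 0 <= b i)%E ->
  ((n%:R^-1 ^+ 2)%:E * \sum_(i < n) (v + a i + b i) =
   n%:R^-1%:E * (v + n%:R^-1%:E * \sum_(i < n) a i
     + n%:R^-1%:E * \sum_(i < n) b i))%E.
Proof.
move=> n0 v0 a0 b0; rewrite expr2 EFinM -muleA; congr (_ * _)%E.
rewrite !big_split/=.
have sa0 : (0 <= \sum_(i < n) a i)%E by exact: sume_ge0.
have sb0 : (0 <= \sum_(i < n) b i)%E by exact: sume_ge0.
have -> : (\sum_(i < n) v)%E = (n%:R%:E * v)%E.
  by rewrite sumr_const card_ord mule_natl.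
have nv0 : (0 <= n%:R%:E * v)%E by rewrite mule_ge0// lee_fin.
rewrite ge0_muleDr ?adde_ge0// ge0_muleDr// muleA -EFinM mulVf ?mul1e//.
by rewrite pnatr_eq0 -lt0n.
Qed.



Theorem theorem1
  (R : realType) (dX dA dO : measure_display)
  (TX : measurableType dX) (TA : measurableType dA)
  (Omega : measurableType dO) (P : probability Omega R)
  (lamA : {sigma_finite_measure set TA -> \bar R})
  (Xi : probability TX R) (Gam : R.-pker (TX * TA) ~> R)
  (g : TX -> TA -> R)
  (n : nat)
  (pi : forall i : nat, i.-tuple (obs R TX TA) -> TX -> TA -> R)
  (muhat : forall i : nat, i.-tuple (obs R TX TA) -> TX -> TA -> R)
  (Ob : nat -> Omega -> obs R TX TA) :
  (0 < n)%N ->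
  (* g is measurable *)
  measurable_fun setT (fun z : TX * TA => g z.1 z.2) ->
  (* pi_i^* is a (jointly measurable) density of a Markov kernel w.r.t. lambda_A *)
  (forall i : nat, measurable_fun setT
     (fun z : i.-tuple (obs R TX TA) * TX * TA => pi i z.1.1 z.1.2 z.2)) ->
  (forall i h x a, 0 <= pi i h x a) ->
  (forall i h x, (\int[lamA]_a ((pi i h x a)%:E) = 1)%E) ->
  (* overlap: the density is positive wherever g does not vanish *)
  (forall i h x a, g x a != 0 -> 0 < pi i h x a) ->
  (* mu-hat_i depends measurably only on O_{i-1} *)
  (forall i : nat, measurable_fun setT
     (fun z : i.-tuple (obs R TX TA) * TX * TA => muhat i z.1.1 z.1.2 z.2)) ->
  (* finite second moments of Gamma (so mu^* and sigma^2 are finite) *)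
  (forall x a, (Gam (x, a)).-integrable setT (fun y : R => (y ^+ 2)%:E)) ->
  (* the inner products appearing are well defined (finite) *)
  (forall x, lamA.-integrable setT (fun a => (g x a * mustar Gam x a)%:E)) ->
  (forall i h x, lamA.-integrable setT (fun a => (g x a * muhat i h x a)%:E)) ->
  Xi.-integrable setT (fun x => (ipA lamA (g x) (mustar Gam x))%:E) ->
  (* the observations are random variables *)
  (forall i, (i < n)%N -> measurable_fun setT (Ob i)) ->
  (* sequential data generation under I^*: conditionally on O_{i-1},
     X_i ~ Xi, A_i ~ Pi_i^*(. | X_i, O_{i-1}), Y_i ~ Gamma(. | X_i, A_i) *)
  (forall i : nat, (i < n)%N ->
   forall F : i.-tuple (obs R TX TA) * (obs R TX TA) -> \bar R,
     measurable_fun setT F -> (forall z, 0 <= F z)%E ->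
     (\int[P]_w F (hist Ob i w, Ob i w)
      = \int[P]_w \int[Xi]_x \int[lamA]_a
          ((pi i (hist Ob i w) x a)%:E *
           \int[Gam (x, a)]_y F (hist Ob i w, (x, a, y))))%E) ->
  let X i w := (Ob i w).1.1 in
  let A i w := (Ob i w).1.2 in
  let Y i w := (Ob i w).2 in
  let Gamhat i w :=
    g (X i w) (A i w) / pi i (hist Ob i w) (X i w) (A i w)
      * (Y i w - muhat i (hist Ob i w) (X i w) (A i w))
    + ipA lamA (g (X i w)) (muhat i (hist Ob i w) (X i w)) in
  let tauhat w := n%:R^-1 * \sum_(i < n) Gamhat i w in
  let tau := tau_star Xi lamA Gam g in
  let sigma_norm2 :=
    ((n%:R^-1)%:E * \sum_(i < n) \int[P]_w
      (((g (X i w) (A i w)) ^+ 2 * sigma2 Gam (X i w) (A i w)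
        / (pi i (hist Ob i w) (X i w) (A i w)) ^+ 2)%:E))%E in
  let v2 := (var_gmu Xi lamA Gam g + sigma_norm2)%E in
  let err :=
    ((n%:R^-1)%:E * \sum_(i < n) \int[P]_w
      (((g (X i w) (A i w)) ^+ 2
        * (muhat i (hist Ob i w) (X i w) (A i w) - mustar Gam (X i w) (A i w)) ^+ 2
        / (pi i (hist Ob i w) (X i w) (A i w)) ^+ 2)%:E))%E in
  (\int[P]_w (((tauhat w - tau) ^+ 2)%:E)
     <= (n%:R^-1)%:E * (v2 + err))%E.
Proof.
move=> n0 mg mpi pi0 pi1 gpi mmuhat Gam2 gmu gmuhat ipi mOb law.
cbv zeta; pose X i w := (Ob i w).1.1; pose A i w := (Ob i w).1.2.
have main := le_integral_score_dev_sum mg mpi pi0 pi1 gpi mmuhat Gam2 gmu gmuhat ipi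
  mOb law (leqnn n).
pose a i := (\int[P]_w ((g (X i w) (A i w)) ^+ 2 * sigma2 Gam (X i w) (A i w)
        / (pi i (hist Ob i w) (X i w) (A i w)) ^+ 2)%:E)%E.
pose b i := (\int[P]_w ((g (X i w) (A i w)) ^+ 2
        * (muhat i (hist Ob i w) (X i w) (A i w) - mustar Gam (X i w) (A i w)) ^+ 2
        / (pi i (hist Ob i w) (X i w) (A i w)) ^+ 2)%:E)%E.
have v0 : (0 <= var_gmu Xi lamA Gam g)%E.
  by apply: integral_ge0 => x _; rewrite lee_fin sqr_ge0.
have a0 i : (0 <= a i)%E.
  apply: integral_ge0 => w _; rewrite lee_fin.
  by rewrite mulr_ge0 ?invr_ge0 ?sqr_ge0// mulr_ge0 ?sqr_ge0 ?sigma2_ge0.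
have b0 i : (0 <= b i)%E.
  apply: integral_ge0 => w _; rewrite lee_fin.
  by rewrite mulr_ge0 ?invr_ge0 ?sqr_ge0// mulr_ge0 ?sqr_ge0.
have nn0 : n%:R != 0 :> R by rewrite pnatr_eq0 -lt0n.
rewrite -(mean_sum_addE n0 v0 a0 b0).
(* Moving the target inside the average makes the estimation error [n%:R^-1] times the sum of the
   centred scores. *)
have devE w : (n%:R^-1 * \sum_(i < n)
    (g (X i w) (A i w) / pi i (hist Ob i w) (X i w) (A i w)
      * ((Ob i w).2 - muhat i (hist Ob i w) (X i w) (A i w))
    + ipA lamA (g (X i w)) (muhat i (hist Ob i w) (X i w)))
    - tau_star Xi lamA Gam g) ^+ 2 = n%:R^-1 ^+ 2 *
    score_dev_sum lamA Xi Gam g pi muhat (hist Ob n w) ^+ 2.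
  rewrite score_dev_sum_hist -exprMn /score_dev sumrB sumr_const card_ord.
  by rewrite mulrBr -(mulr_natl (tau_star _ _ _ _)) mulKf.
under eq_integral do rewrite devE EFinM.
rewrite ge0_integralZl_EFin ?sqr_ge0//; first last.
- apply/measurable_EFinP; apply: measurable_funX.
  have := measurableT_comp (measurable_score_dev_sum lamA Xi Gam mg mpi pi0 mmuhat
    (j := n)) (measurable_hist mOb (leqnn n)).
  exact.
- by move=> w _; rewrite lee_fin sqr_ge0.
by rewrite lee_wpmul2l// lee_fin sqr_ge0.
Qed.
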